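(* Let $\mathrm{mCoarse}$ denote the category of metric spaces and coarse maps modulo closeness, and let $\mathrm{Top}$ denote the category of topological spaces and continuous maps. Then the functor $\nu':\mathrm{mCoarse}\to \mathrm{Top}$, which sends a metric space $X$ to its corona $\nu'(X)$ and the class of a coarse map $f$ to $\nu'(f)$, is faithful.
   Context: Metrics take finite values. A subset $E\subseteq X\times X$ of a metric space $(X,d)$ is an entourage if $\sup_{(x,y)\in E}d(x,y)<\infty$. For $A\subseteq X$ write $E[A]=\{x\in X:(x,a)\in E\text{ for some }a\in A\}$. A map $f:X\to Y$ between metric spaces is coarse if $(f\times f)(E)$ is an entourage of $Y$ for every entourage $E$ of $X$, and $f^{-1}(B)$ is bounded for every bounded $B\subseteq Y$. Two maps $f,g:X\to Y$ are close if $\{(f(x),g(x)):x\in X\}$ is an entourage of $Y$. For $A,B\subseteq X$ write $A\curlywedge B$ (''not coarsely disjoint'') if there is an entourage $E$ of $X$ such that $E[A]\cap E[B]$ is not bounded. A coarse ultrafilter on $X$ is a system $\mathcal F$ of subsets of $X$ such that: (1) $A,B\in\mathcal F$ implies $A\curlywedge B$; (2) if $A,B\subseteq X$ and $A\cup B\in\mathcal F$ then $A\in\mathcal F$ or $B\in\mathcal F$; (3) $X\in\mathcal F$. Two coarse ultrafilters $\mathcal F,\mathcal G$ on $X$ are asymptotically alike, $\mathcal F\lambda\mathcal G$, if $A\curlywedge B$ for all $A\in\mathcal F$, $B\in\mathcal G$; this is an equivalence relation. The corona $\nu'(X)$ is the set of coarse ultrafilters on $X$ modulo $\lambda$. For $A\subseteq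 X$ put $\mathrm{cl}(A)=\{[\mathcal F]\in\nu'(X):A\in\mathcal F\}$. The topology on $\nu'(X)$ is the one generated by the sets $\mathrm{cl}(A)^c$, $A\subseteq X$; equivalently it is induced by the proximity relation in which $\pi_1,\pi_2\subseteq \nu'(X)$ are not near iff there are $A,B\subseteq X$ with $A\curlywedge B$ false, $\pi_1\subseteq\mathrm{cl}(A)$, $\pi_2\subseteq\mathrm{cl}(B)$. For a coarse map $f:X\to Y$, $f_*\mathcal F=\{A\subseteq Y:f^{-1}(A)\in\mathcal F\}$ is a coarse ultrafilter on $Y$, and $\nu'(f):\nu'(X)\to\nu'(Y)$, $[\mathcal F]\mapsto[f_*\mathcal F]$, is the induced continuous map. *)

(* Defs.v *)
From HB Require Import structures.
From mathcomp Require Import all_boot all_order all_algebra.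
From mathcomp Require Import finmap all_classical all_reals topology.

Set Implicit Arguments.
Unset Strict Implicit.
Unset Printing Implicit Defensive.

Import Order.TTheory GRing.Theory Num.Theory.

Local Open Scope classical_set_scope.
Local Open Scope ring_scope.
Local Open Scope quotient_scope.

Record category := Category {
  obj :> Type;
  hom : obj -> obj -> Type;
  idm : forall a, hom a a;
  compm : forall a b c, hom b c -> hom a b -> hom a c;
  compA : forall a b c d (h : hom c d) (g : hom b c) (f : hom a b),
    compm h (compm g f) = compm (compm h g) f;
  comp1m : forall a b (f : hom a b), compm (idm b) f = f;
  compm1 : forall a b (f : hom a b), compm f (idm a) = f
}.
Arguments hom {_} _ _.
Arguments idm {_} _.
Arguments compm {_ _ _ _} _ _.

Record functor (C D : category) := Functor {
  fobj :> C -> D;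
  fmap : forall a b : C, hom a b -> hom (fobj a) (fobj b);
  fmap1 : forall a : C, fmap (idm a) = idm (fobj a);
  fmapM : forall (a b c : C) (g : hom b c) (f : hom a b),
    fmap (compm g f) = compm (fmap g) (fmap f)
}.
Arguments fmap {_ _} _ {_ _} _.

Definition faithful (C D : category) (F : functor C D) : Prop :=
  forall a b : C, injective (fmap F : hom a b -> hom (F a) (F b)).

Section Top.

Let ctsid (X : topologicalType) : continuousType X X := @idfun X.

Let ctscomp (X Y Z : topologicalType)
  (g : continuousType Y Z) (f : continuousType X Y) : continuousType X Z :=
  g \o f.

Let ctscompA (X Y Z W : topologicalType) (h : continuousType Z W)
    (g : continuousType Y Z) (f : continuousType X Y) :
  ctscomp h (ctscomp g f) = ctscomp (ctscomp h g) f.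
Proof. exact/continuousEP. Qed.

Let ctscomp1m (X Y : topologicalType) (f : continuousType X Y) :
  ctscomp (ctsid Y) f = f.
Proof. exact/continuousEP. Qed.

Let ctscompm1 (X Y : topologicalType) (f : continuousType X Y) :
  ctscomp f (ctsid X) = f.
Proof. exact/continuousEP. Qed.

Definition Top : category := Category ctscompA ctscomp1m ctscompm1.

End Top.

Section coarse_structure.
Context {R : realType} {X : metricType R}.
Implicit Types (E : set (X * X)) (A B : set X).

(* [entourage] already denotes the entourages of the uniformity of [X]. *)
Definition coarse_entourage E : Prop :=
  has_ubound [set mdist p.1 p.2 | p in E].

Definition bounded A : Prop := coarse_entourage (A `*` A).

Definition thicken E A : set X := [set x | exists2 a, A a & E (x, a)].

(* A and B are not coarsely disjoint *)
Definition coarsely_near A B : Prop :=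
  exists E, coarse_entourage E /\ ~ bounded (thicken E A `&` thicken E B).

Let coarse_entourageP E :
  coarse_entourage E <-> exists r, forall x y, E (x, y) -> mdist x y <= r.
Proof.
split=> [[r Er]|[r Er]]; exists r.
  by move=> x y Exy; apply: Er; exists (x, y).
by move=> _ [[x y] Exy <-]; exact: Er.
Qed.

Lemma coarse_entourage_le E :
  (exists r, forall x y, E (x, y) -> mdist x y <= r) -> coarse_entourage E.
Proof. by move/coarse_entourageP. Qed.

Lemma coarse_entourage_bound E : coarse_entourage E ->
  exists r, forall x y, E (x, y) -> mdist x y <= r.
Proof. by move/coarse_entourageP. Qed.

Lemma sub_bounded A B : A `<=` B -> bounded B -> bounded A.
Proof.
move=> AB /coarse_entourageP[r Br]; apply/coarse_entourageP; exists r => x y.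
by case=> /= Ax Ay; apply: Br; split; exact: AB.
Qed.

Definition rnear (r : R) A : set X := [set x | exists2 a, A a & mdist x a <= r].

Lemma coarse_entourage_rball (r : R) :
  coarse_entourage [set p : X * X | mdist p.1 p.2 <= r].
Proof. by apply/coarse_entourageP; exists r. Qed.

Lemma coarsely_nearP A B :
  coarsely_near A B <-> exists r, ~ bounded (rnear r A `&` rnear r B).
Proof.
split=> [[E [/coarse_entourageP[r Er] Eub]]|[r rub]].
  exists r; apply: contra_not Eub; apply: sub_bounded => x.
  by case=> -[a Aa xa] [b Bb xb]; split; [exists a|exists b] => //; exact: Er.
exists [set p : X * X | mdist p.1 p.2 <= r]; split=> //.
exact: coarse_entourage_rball.
Qed.

Lemma coarsely_nearC A B : coarsely_near A B -> coarsely_near B A.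
Proof. by case=> E [Ee Eub]; exists E; split=> //; rewrite setIC. Qed.

Lemma coarsely_near_rnear (s : R) A B B' : B' `<=` rnear s B ->
  coarsely_near A B' -> coarsely_near A B.
Proof.
move=> B'B /coarsely_nearP[r rub]; apply/coarsely_nearP.
exists (Num.max r (r + s)); apply: contra_not rub; apply: sub_bounded => x.
case=> -[a Aa xa] [b' /B'B[b Bb b'b] xb']; split; [exists a|exists b] => //.
  by rewrite le_max xa.
rewrite le_max; apply/orP; right.
by apply: le_trans (metric_triangle x b' b) _; exact: lerD.
Qed.

Lemma coarsely_nearS A B A' B' : A `<=` A' -> B `<=` B' ->
  coarsely_near A B -> coarsely_near A' B'.
Proof.
move=> AA' BB' [E [Ee Eub]]; exists E; split=> //; apply: contra_not Eub.
apply: sub_bounded => x [[a Aa xa] [b Bb xb]].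
by split; [exists a => //; exact: AA'|exists b => //; exact: BB'].
Qed.

Lemma boundedU A B : bounded A -> bounded B -> bounded (A `|` B).
Proof.
move=> bA bB.
have [->|/set0P[a Aa]] := eqVneq A set0; first by rewrite set0U.
have [->|/set0P[b Bb]] := eqVneq B set0; first by rewrite setU0.
move: bA bB => /coarse_entourageP[r Ar] /coarse_entourageP[s Bs].
have xa x : (A `|` B) x -> mdist x a <= Num.max r (s + mdist b a).
  rewrite le_max => -[Ax|Bx]; first by rewrite Ar.
  apply/orP; right; apply: le_trans (metric_triangle _ b _) _.
  by rewrite lerD2r; exact: Bs.
set t := Num.max _ _ in xa.
apply/coarse_entourageP; exists (t + t) => x y [/= ABx ABy].
apply: le_trans (metric_triangle _ a _) _.
by rewrite lerD// ?xa// metric_sym xa.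
Qed.

Lemma coarsely_nearUl A B S :
  coarsely_near (A `|` B) S -> coarsely_near A S \/ coarsely_near B S.
Proof.
case=> E [Ee Eub]; apply: contrapT => /not_orP[AS BS]; apply: Eub.
have bd C : ~ coarsely_near C S -> bounded (thicken E C `&` thicken E S).
  by move=> CS; apply: contrapT => Cub; apply: CS; exists E.
apply: sub_bounded (boundedU (bd _ AS) (bd _ BS)) => x.
by case=> -[a [Aa|Ba] xa] xS; [left|right]; split=> //; exists a.
Qed.

Lemma coarsely_near_sep A B : ~ coarsely_near A B ->
  exists D, ~ coarsely_near A D /\ ~ coarsely_near B (~` D).
Proof.
move=> AB.
exists [set x | exists2 b, B b & forall a, A a -> mdist x b <= mdist x a].
split; apply: contra_not AB => /coarsely_nearP[r rub]; apply/coarsely_nearP;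
  exists (Num.max r (r + (r + r))); apply: contra_not rub;
  apply: sub_bounded => z.
- case=> -[a Aa za] [x [b Bb xbA] zx]; split.
    by exists a => //; rewrite le_max za.
  exists b => //; rewrite le_max; apply/orP; right.
  apply: le_trans (metric_triangle z x b) _; apply: lerD => //.
  apply: le_trans (xbA _ Aa) _; apply: le_trans (metric_triangle x z a) _.
  by rewrite metric_sym; exact: lerD.
- case=> -[b Bb zb] [x Dx zx]; split; last by exists b => //; rewrite le_max zb.
  have [a Aa xab] : exists2 a, A a & mdist x a <= mdist x b.
    apply: contrapT => nxa; apply: Dx; exists b => // a Aa.
    case: (leP (mdist x b) (mdist x a)) => // /ltW xab.
    by exfalso; apply: nxa; exists a.
  exists a => //; rewrite le_max; apply/orP; right.
  apply: le_trans (metric_triangle z x a) _; apply: lerD => //.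
  apply: le_trans xab _; apply: le_trans (metric_triangle x z b) _.
  by rewrite metric_sym; exact: lerD.
Qed.

End coarse_structure.

Section coarse_maps.
Context {R : realType}.

Definition is_coarse (X Y : metricType R) (f : X -> Y) : Prop :=
  (forall E, coarse_entourage E ->
     coarse_entourage [set (f p.1, f p.2) | p in E]) /\
  (forall B, bounded B -> bounded (f @^-1` B)).

Record coarse_map (X Y : metricType R) := CoarseMap {
  cfun :> X -> Y;
  cfunP : is_coarse cfun
}.

HB.instance Definition _ (X Y : metricType R) := gen_eqMixin (coarse_map X Y).
HB.instance Definition _ (X Y : metricType R) :=
  gen_choiceMixin (coarse_map X Y).

Definition close_maps (X Y : metricType R) (f g : X -> Y) : Prop :=
  coarse_entourage [set (f x, g x) | x in setT].

Lemma close_mapsP (X Y : metricType R) (f g : X -> Y) :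
  close_maps f g <-> exists r, forall x, mdist (f x) (g x) <= r.
Proof.
split=> [/coarse_entourage_bound[r fgr]|[r fgr]].
  by exists r => x; apply: fgr; exists x.
by apply: coarse_entourage_le; exists r => _ _ [x _ [<- <-]].
Qed.

Lemma is_coarse_bound (X Y : metricType R) (f : coarse_map X Y) (r : R) :
  exists s, forall x y, mdist x y <= r -> mdist (f x) (f y) <= s.
Proof.
have [/(_ _ (coarse_entourage_rball r))/coarse_entourage_bound[s fs] _] :=
  cfunP f.
by exists s => x y xyr; apply: fs; exists (x, y).
Qed.

Lemma is_coarse_id (X : metricType R) : is_coarse (@idfun X).
Proof.
split=> // E /coarse_entourage_bound[r Er]; apply: coarse_entourage_le.
by exists r => _ _ [[x y] Exy [<- <-]]; exact: Er.
Qed.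

Lemma is_coarse_comp (X Y Z : metricType R)
  (g : coarse_map Y Z) (f : coarse_map X Y) : is_coarse (g \o f).
Proof.
split=> [E /coarse_entourage_bound[r Er]|B Bb].
  have [s fs] := is_coarse_bound f r; have [t gt] := is_coarse_bound g s.
  apply: coarse_entourage_le; exists t => _ _ [[x y] Exy [<- <-]] /=.
  exact/gt/fs/Er.
by rewrite comp_preimage; apply: (cfunP f).2; exact: (cfunP g).2.
Qed.

Definition coarse_id (X : metricType R) := CoarseMap (@is_coarse_id X).

Definition coarse_comp (X Y Z : metricType R)
  (g : coarse_map Y Z) (f : coarse_map X Y) := CoarseMap (is_coarse_comp g f).

Lemma close_maps_refl (X Y : metricType R) (f : X -> Y) : close_maps f f.
Proof. by apply/close_mapsP; exists 0 => x; rewrite mdistxx. Qed.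

Lemma close_maps_sym (X Y : metricType R) (f g : X -> Y) :
  close_maps f g -> close_maps g f.
Proof.
by move=> /close_mapsP[r fgr]; apply/close_mapsP; exists r => x;
  rewrite metric_sym.
Qed.

Lemma close_maps_trans (X Y : metricType R) (g f h : X -> Y) :
  close_maps f g -> close_maps g h -> close_maps f h.
Proof.
move=> /close_mapsP[r fgr] /close_mapsP[s ghs]; apply/close_mapsP.
exists (r + s) => x.
by apply: le_trans (metric_triangle _ (g x) _) _; exact: lerD.
Qed.

Lemma close_maps_comp (X Y Z : metricType R)
    (g g' : coarse_map Y Z) (f f' : coarse_map X Y) :
  close_maps g g' -> close_maps f f' ->
  close_maps (coarse_comp g f) (coarse_comp g' f').
Proof.
move=> /close_mapsP[r gr] /close_mapsP[s fs]; apply/close_mapsP.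
have [t gt] := is_coarse_bound g s; exists (t + r) => x /=.
apply: le_trans (metric_triangle _ (g (f' x)) _) _.
by apply: lerD (gr _); exact/gt.
Qed.

Definition closeb (X Y : metricType R) (f g : coarse_map X Y) : bool :=
  `[< close_maps f g >].

Let closeb_refl (X Y : metricType R) : reflexive (@closeb X Y).
Proof. by move=> f; apply/asboolP/close_maps_refl. Qed.

Let closeb_sym (X Y : metricType R) : symmetric (@closeb X Y).
Proof. by move=> f g; apply/idP/idP => /asboolP/close_maps_sym/asboolP. Qed.

Let closeb_trans (X Y : metricType R) : transitive (@closeb X Y).
Proof.
by move=> g f h /asboolP fg /asboolP gh; apply/asboolP/(close_maps_trans fg gh).
Qed.

Canonical closeb_equiv (X Y : metricType R) :=
  EquivRel (@closeb X Y) (@closeb_refl X Y) (@closeb_sym X Y)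
    (@closeb_trans X Y).

Definition coarse_class (X Y : metricType R) : Type := {eq_quot @closeb X Y}.
HB.instance Definition _ (X Y : metricType R) := Choice.on (coarse_class X Y).
HB.instance Definition _ (X Y : metricType R) :=
  EqQuotient.on (coarse_class X Y).

Lemma coarse_classP (X Y : metricType R) (f g : coarse_map X Y) :
  \pi_(coarse_class X Y) f = \pi_(coarse_class X Y) g <-> close_maps f g.
Proof.
by split=> [/eqmodP/asboolP|fg]; [|apply/eqmodP/asboolP].
Qed.

Definition class_id (X : metricType R) : coarse_class X X :=
  \pi_(coarse_class X X) (coarse_id X).

Definition class_comp (X Y Z : metricType R)
    (g : coarse_class Y Z) (f : coarse_class X Y) : coarse_class X Z :=
  \pi_(coarse_class X Z) (coarse_comp (repr g) (repr f)).

Lemma close_maps_repr (X Y : metricType R) (f : coarse_map X Y) :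
  close_maps (repr (\pi_(coarse_class X Y) f)) f.
Proof. by apply/coarse_classP; rewrite reprK. Qed.

Lemma class_comp_pi (X Y Z : metricType R)
    (g : coarse_map Y Z) (f : coarse_map X Y) :
  class_comp (\pi_(coarse_class Y Z) g) (\pi_(coarse_class X Y) f) =
  \pi_(coarse_class X Z) (coarse_comp g f).
Proof. by apply/coarse_classP/close_maps_comp; exact: close_maps_repr. Qed.

Lemma class_compA (X Y Z W : metricType R) (h : coarse_class Z W)
    (g : coarse_class Y Z) (f : coarse_class X Y) :
  class_comp h (class_comp g f) = class_comp (class_comp h g) f.
Proof.
elim/quotW: h => h; elim/quotW: g => g; elim/quotW: f => f.
rewrite (class_comp_pi g f) (class_comp_pi h g) !class_comp_pi.
apply/coarse_classP.
exact: (@close_maps_refl _ _ (h \o g \o f)).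
Qed.

Lemma class_comp1m (X Y : metricType R) (f : coarse_class X Y) :
  class_comp (class_id Y) f = f.
Proof.
elim/quotW: f => f; rewrite class_comp_pi; apply/coarse_classP.
exact: (@close_maps_refl _ _ f).
Qed.

Lemma class_compm1 (X Y : metricType R) (f : coarse_class X Y) :
  class_comp f (class_id X) = f.
Proof.
elim/quotW: f => f; rewrite class_comp_pi; apply/coarse_classP.
exact: (@close_maps_refl _ _ f).
Qed.

End coarse_maps.

Definition mCoarse (R : realType) : category :=
  Category (@class_compA R) (@class_comp1m R) (@class_compm1 R).

Section corona.
Context {R : realType}.

Definition is_coarse_ultrafilter (X : metricType R) (F : set (set X)) : Prop :=
  [/\ forall A B, F A -> F B -> coarsely_near A B,
      forall A B, F (A `|` B) -> F A \/ F B
    & F setT].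

Record coarse_ultrafilter (X : metricType R) := CoarseUltrafilter {
  cuf :> set X -> Prop;
  cufP : is_coarse_ultrafilter cuf
}.

HB.instance Definition _ (X : metricType R) :=
  gen_eqMixin (coarse_ultrafilter X).
HB.instance Definition _ (X : metricType R) :=
  gen_choiceMixin (coarse_ultrafilter X).

Lemma cufC (X : metricType R) (F : coarse_ultrafilter X) A : F A \/ F (~` A).
Proof.
have [_ FU FT] := cufP F.
by apply: FU; rewrite setUv.
Qed.

Definition asymptotically_alike (X : metricType R)
    (F G : coarse_ultrafilter X) : Prop :=
  forall A B, F A -> G B -> coarsely_near A B.

Lemma alike_refl (X : metricType R) (F : coarse_ultrafilter X) :
  asymptotically_alike F F.
Proof. by case: (cufP F). Qed.

Definition alikeb (X : metricType R) (F G : coarse_ultrafilter X) : bool :=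
  `[< asymptotically_alike F G >].

Let alikeb_refl (X : metricType R) : reflexive (@alikeb X).
Proof. by move=> F; apply/asboolP/alike_refl. Qed.

Let alikeb_sym (X : metricType R) : symmetric (@alikeb X).
Proof.
by move=> F G; apply/idP/idP => /asboolP FG; apply/asboolP => A B FA GB;
  apply/coarsely_nearC/FG.
Qed.

Let alikeb_trans (X : metricType R) : transitive (@alikeb X).
Proof.
move=> G F H /asboolP FG /asboolP GH; apply/asboolP => A B FA HB.
apply: contrapT => /coarsely_near_sep[D [AD BD]].
have [GD|GD] := cufC G D; first by apply: AD; exact: FG.
by apply: BD; apply/coarsely_nearC/GH.
Qed.

Canonical alikeb_equiv (X : metricType R) :=
  EquivRel (@alikeb X) (@alikeb_refl X) (@alikeb_sym X) (@alikeb_trans X).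

Definition corona (X : metricType R) : Type := {eq_quot @alikeb X}.
HB.instance Definition _ (X : metricType R) := Choice.on (corona X).
HB.instance Definition _ (X : metricType R) := EqQuotient.on (corona X).

Lemma coronaP (X : metricType R) (F G : coarse_ultrafilter X) :
  \pi_(corona X) F = \pi_(corona X) G <-> asymptotically_alike F G.
Proof.
by split=> [/eqmodP/asboolP|FG]; [|apply/eqmodP/asboolP].
Qed.

(* Membership of A may depend on the representative F of a class: a class is in
   cl A as soon as one of its representatives contains A. *)
Definition cl (X : metricType R) (A : set X) : set (corona X) :=
  [set \pi_(corona X) F | F in [set F : coarse_ultrafilter X | F A]].

HB.instance Definition _ (X : metricType R) :=
  isSubBaseTopological.Build (corona X) [set: set X] (fun A => ~` cl A).

Lemma clP (X : metricType R) (A : set X) (F : coarse_ultrafilter X) :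
  cl A (\pi_(corona X) F) <-> forall B, F B -> coarsely_near A B.
Proof.
have [FI FU FT] := cufP F.
split=> [[G GA /coronaP GF] B FB|AF]; first exact: GF.
have Gcuf : is_coarse_ultrafilter
    [set C | forall B, F B -> coarsely_near C B].
  split=> [C D FC FD|C D FCD|B FB].
  - apply: contrapT => /coarsely_near_sep[S [CS DS]].
    by have [/FC|/FD] := cufC F S.
  - apply: contrapT => /not_orP[/existsNP[S /not_implyP[FS CS]]].
    move=> /existsNP[T /not_implyP[FT' DT]].
    have [U [CU SU]] := coarsely_near_sep CS.
    have FTU : F (T `&` U).
      have : F ((T `&` U) `|` (T `\` U)) by rewrite setUIDK.
      move=> /FU[//|FTU]; exfalso; apply: SU.
      by apply: coarsely_nearS (FI _ _ FS FTU) => // x [].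
    have [CTU|DTU] := coarsely_nearUl (FCD _ FTU).
      by apply: CU; apply: coarsely_nearS CTU => // x [].
    by apply: DT; apply: coarsely_nearS DTU => // x [].
  - by apply: coarsely_nearS (FI _ _ FT FB).
exists (CoarseUltrafilter Gcuf) => //.
by apply/coronaP => C D; apply.
Qed.

Lemma open_cl (X : metricType R) (A : set X) : open (~` cl A : set (corona X)).
Proof.
exists [set ~` cl A]; last by rewrite bigcup_set1.
move=> _ ->; exists [fset A]%fset => [? _|]; first by rewrite inE.
by rewrite set_fset1 bigcap_set1.
Qed.

Lemma coarsely_near_preimage (X Y : metricType R) (f : coarse_map X Y)
    (A B : set Y) :
  coarsely_near (f @^-1` A) (f @^-1` B) -> coarsely_near A B.
Proof.
move=> /coarsely_nearP[r rub]; have [s fs] := is_coarse_bound f r.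
apply/coarsely_nearP; exists s; apply: contra_not rub => sb.
apply: sub_bounded ((cfunP f).2 _ sb) => x [[a Aa xa] [b Bb xb]].
by split; [exists (f a)|exists (f b)] => //; exact: fs.
Qed.

Lemma is_coarse_ultrafilter_push (X Y : metricType R) (f : coarse_map X Y)
    (F : coarse_ultrafilter X) :
  is_coarse_ultrafilter [set A : set Y | F (f @^-1` A)].
Proof.
have [FI FU FT] := cufP F; split=> [A B FA FB|A B|//].
  by apply: (@coarsely_near_preimage _ _ f); exact: FI.
by rewrite /= preimage_setU => /FU.
Qed.

Definition cuf_push (X Y : metricType R) (f : coarse_map X Y)
    (F : coarse_ultrafilter X) : coarse_ultrafilter Y :=
  CoarseUltrafilter (is_coarse_ultrafilter_push f F).

Lemma cuf_push_alike (X Y : metricType R) (f g : coarse_map X Y)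
    (F G : coarse_ultrafilter X) :
  close_maps f g -> asymptotically_alike F G ->
  asymptotically_alike (cuf_push f F) (cuf_push g G).
Proof.
move=> /close_mapsP[r fg] FG A B FA GB.
apply: (@coarsely_near_rnear _ _ r A B (rnear r B)) => //.
apply: (@coarsely_near_preimage _ _ f).
apply: coarsely_nearS (FG _ _ FA GB) => // x Bgx.
by exists (g x).
Qed.

Definition corona_map (X Y : metricType R) (f : coarse_map X Y) :
    corona X -> corona Y :=
  fun c => \pi_(corona Y) (cuf_push f (repr c)).

Lemma corona_mapE (X Y : metricType R) (f : coarse_map X Y)
    (F : coarse_ultrafilter X) :
  corona_map f (\pi_(corona X) F) = \pi_(corona Y) (cuf_push f F).
Proof.
apply/coronaP/cuf_push_alike; first exact: close_maps_refl.
by apply/coronaP; rewrite reprK.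
Qed.

Lemma corona_map_close (X Y : metricType R) (f g : coarse_map X Y) :
  close_maps f g -> corona_map f = corona_map g.
Proof.
move=> fg; apply/funext; elim/quotW => F; rewrite !corona_mapE.
by apply/coronaP/cuf_push_alike => //; exact/coronaP.
Qed.

Lemma corona_map_cl (X Y : metricType R) (f : coarse_map X Y) (B : set Y)
    (c : corona X) : ~ cl B (corona_map f c) ->
  exists2 D : set X, ~ cl D c &
    ~` cl D `<=` corona_map f @^-1` (~` cl B).
Proof.
elim/quotW: c => F; rewrite corona_mapE => /clP/existsNP[C /not_implyP[FC BC]].
have [D [BD CD]] := coarsely_near_sep BC.
exists (f @^-1` (~` D)).
  by move=> /clP/(_ _ FC)/(@coarsely_near_preimage _ _ f)/coarsely_nearC.
elim/quotW => G GD /=; rewrite corona_mapE => /clP GB; apply: GD.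
have [GfD|GfD] := cufC G (f @^-1` D); first by have := GB _ GfD.
by exists G.
Qed.

Lemma corona_map_continuous (X Y : metricType R) (f : coarse_map X Y) :
  continuous (corona_map f).
Proof.
move=> c A /=; rewrite (@nbhsE (corona Y)) => -[_ [[B sB <-] [C BC Cc] sUBA]].
rewrite nbhs_filterE /=.
apply: (@filterS _ _ _ (corona_map f @^-1` C)).
  by move=> d Cd; apply: sUBA; exists C.
have /sB[I sI IC] := BC; rewrite -IC preimage_bigcap.
apply: filter_bigI => D DI.
have /corona_map_cl[S Sc SD] : ~ cl D (corona_map f c).
  by move: Cc; rewrite -IC => /(_ _ DI).
apply: filterS SD _; apply: open_nbhs_nbhs; split=> //; exact: open_cl.
Qed.

Definition corona_hom (X Y : metricType R) (f : coarse_class X Y) :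
    continuousType (corona X) (corona Y) :=
  mkcts (@corona_map_continuous X Y (repr f)).

Lemma corona_homE (X Y : metricType R) (f : coarse_map X Y) :
  corona_hom (\pi_(coarse_class X Y) f) = corona_map f :> (_ -> _).
Proof. exact/corona_map_close/close_maps_repr. Qed.

Lemma corona_hom1 (X : metricType R) :
  corona_hom (class_id X) = idm (corona X : Top).
Proof.
apply/continuousEP => c; rewrite corona_homE; elim/quotW: c => F.
by rewrite corona_mapE; apply/coronaP => A B; exact: (@alike_refl _ F A B).
Qed.

Lemma corona_homM (X Y Z : metricType R) (g : coarse_class Y Z)
    (f : coarse_class X Y) :
  corona_hom (class_comp g f) =
  compm (corona_hom g : @hom Top (corona Y) (corona Z)) (corona_hom f).
Proof.
elim/quotW: g => g; elim/quotW: f => f; rewrite class_comp_pi.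
apply/continuousEP => c /=; rewrite !corona_homE; elim/quotW: c => F.
rewrite (corona_mapE f F) !corona_mapE; apply/coronaP.
by move=> A B; exact: (@alike_refl _ (cuf_push (coarse_comp g f) F) A B).
Qed.

End corona.

Definition corona_functor (R : realType) : functor (mCoarse R) Top :=
  @Functor (mCoarse R) Top (fun X : metricType R => corona X)
    (@corona_hom R) (@corona_hom1 R) (@corona_homM R).

(* Main.v *)
(* For coarse maps [f, g] that are not close there is an unbounded set [A] whose
   images under [f] and [g] are coarsely disjoint.  Both maps are proper and
   [d(f x, g x)] is bounded on bounded sets, so points [x_n] can be picked
   inductively with [d(f x_i, g x_j) > max(i, j)]; take [A] to be the set of the
   [x_n].  An ultrafilter of unbounded sets containing [A] is a coarse
   ultrafilter, and its images under [f] and [g] are not asymptotically alike. *)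
Require Import Defs.
From mathcomp Require Import all_boot all_order all_algebra.
From mathcomp Require Import all_classical all_reals topology.
From mathcomp Require Import lra.

Set Implicit Arguments.
Unset Strict Implicit.
Unset Printing Implicit Defensive.

Import Order.TTheory GRing.Theory Num.Theory.

Local Open Scope classical_set_scope.
Local Open Scope ring_scope.

Section bounded_sets.
Context {R : realType} {X : metricType R}.
Implicit Types A B : set X.

Lemma bounded_ball (a : X) (r : R) A :
  (forall x, A x -> mdist a x <= r) -> bounded A.
Proof.
move=> Ar; apply: coarse_entourage_le; exists (r + r) => x y [/= Ax Ay].
by apply: le_trans (metric_triangle x a y) _; rewrite metric_sym lerD ?Ar.
Qed.

Lemma bounded_set0 : bounded (set0 : set X).
Proof. by apply: coarse_entourage_le; exists 0 => x y []. Qed.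

Lemma coarsely_near_setI A B : ~ bounded (A `&` B) -> coarsely_near A B.
Proof.
move=> ABub; apply/coarsely_nearP; exists 0; apply: contra_not ABub.
by apply: sub_bounded => x [Ax Bx]; split; exists x => //; rewrite mdistxx.
Qed.

(* A coarse ultrafilter need not be upward closed, hence the conclusion about
   all supersets of [A]. *)
Lemma exists_coarse_ultrafilter A :
  ~ bounded A -> exists F : coarse_ultrafilter X, forall B, A `<=` B -> F B.
Proof.
(* [G] consists of the sets that contain [A] up to a bounded remainder; it is proper because [A] is
   unbounded. *)
move=> Aub; pose G : set (set X) := [set S | bounded (A `\` S)].
have GF : ProperFilter G.
  split; first by rewrite /G /= setD0.
  split; rewrite /G /=; first by rewrite setDT; exact: bounded_set0.
    move=> P Q bP bQ; apply: sub_bounded (boundedU bP bQ) => x [Ax].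
    by rewrite /setI /= not_andP => -[nPx|nQx]; [left|right].
  by move=> P Q PQ; apply: sub_bounded => x [Ax nQ]; split=> // /PQ.
have [U [UF GU]] := ultraFilterLemma GF.
(* Complements of bounded sets lie in [G], so no bounded set lies in [U]; hence members of [U] meet
   in unbounded sets. *)
have Uub S : U S -> ~ bounded S.
  move=> US bS; apply: (@filter_not_empty _ U).
  rewrite -(setICr S); apply: filterI => //; apply: GU; rewrite /G /=.
  by apply: sub_bounded bS => x [_ /contrapT].
have Ucuf : is_coarse_ultrafilter U.
  split=> [P Q UP UQ|P Q UPQ|]; last exact: filterT.
    by apply/coarsely_near_setI/Uub; exact: filterI.
  have [|UP] := in_ultra_setVsetC P UF; first by left.
  right; apply: filterS (filterI UPQ UP) => x [[Px nPx|//]].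
  by case: nPx.
exists (CoarseUltrafilter Ucuf) => B AB; apply: GU.
by rewrite /G /= (_ : A `\` B = set0) ?setD_eq0 //; exact: bounded_set0.
Qed.

End bounded_sets.

Section separation.
Context {R : realType} {X Y : metricType R}.
Implicit Types f g : coarse_map X Y.

Lemma coarse_map_dist_bounded f g (B : set X) : bounded B ->
  exists C, forall x, B x -> mdist (f x) (g x) <= C.
Proof.
move=> /coarse_entourage_bound[r Br].
have [->|/set0P[b Bb]] := eqVneq B set0; first by exists 0.
have [s fs] := is_coarse_bound f r; have [t gt] := is_coarse_bound g r.
exists (s + (mdist (f b) (g b) + t)) => x Bx.
apply: le_trans (metric_triangle _ (f b) _) _; apply: lerD.
  by apply/fs/Br.
apply: le_trans (metric_triangle _ (g b) _) _; rewrite lerD2l.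
by apply/gt/Br.
Qed.

Lemma not_close_far f g (y : Y) (r : R) : ~ close_maps f g ->
  exists x, [/\ r < mdist y (f x), r < mdist y (g x) & r < mdist (f x) (g x)].
Proof.
(* By properness [B] is bounded, so [f] and [g] stay within some [C] of each other on it. A point
   where they are farther apart than [C] is therefore outside [B]. *)
move=> fg; pose B := f @^-1` [set z | mdist y z <= r] `|`
                     g @^-1` [set z | mdist y z <= r].
have ball_bounded : bounded [set z | mdist y z <= r].
  exact: (@bounded_ball _ _ y r).
have /(coarse_map_dist_bounded f g)[C BC] : bounded B.
  by apply: boundedU; [apply: (cfunP f).2|apply: (cfunP g).2].
have [x xC] : exists x, Num.max r C < mdist (f x) (g x).
  apply: contrapT => nx; apply: fg; apply/close_mapsP.
  exists (Num.max r C) => x; rewrite leNgt; apply/negP => ?.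
  by apply: nx; exists x.
move: xC; rewrite gt_max => /andP[rx Cx].
have nBx : ~ B x by move=> /BC; rewrite leNgt Cx.
by exists x; split=> //; rewrite ltNge; apply/negP => ?; apply: nBx;
  [left|right].
Qed.

Lemma not_close_separated f g : ~ close_maps f g ->
  exists2 A : set X, ~ bounded A & ~ coarsely_near (f @` A) (g @` A).
Proof.
move=> fg.
have [x0 _] : exists x : X, True.
  apply: contrapT => nX; apply: fg; apply/close_mapsP.
  by exists 0 => x; exfalso; apply: nX; exists x.
pose y := f x0.
have [c cP] := choice (fun r => not_close_far y r fg).
pose rad x := Num.max (mdist y (f x)) (mdist y (g x)).
have radf x : mdist y (f x) <= rad x by rewrite le_max lexx.
have radg x : mdist y (g x) <= rad x by rewrite le_max lexx orbT.
(* [s n] exceeds the distance from [y] to all previously chosen images. *)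
pose s := fix s (n : nat) : R :=
  if n is m.+1 then s m + 1 + rad (c (s m)) else 0.
pose x n := c (s n).
have sS n : s n.+1 = s n + 1 + rad (x n) by [].
have rad_ge0 z : 0 <= rad z by exact: le_trans (mdist_ge0 _ _) (radf z).
have s_ge n : n%:R <= s n.
  by elim: n => // n IH; rewrite sS -natr1 -[leLHS]addr0 lerD ?lerD2r.
have s_gt m n : (m < n)%N -> n%:R + rad (x m) <= s n.
  elim: n => // n IH; rewrite ltnS leq_eqVlt => /predU1P[->|/IH {}IH].
    by rewrite sS lerD2r -natr1 lerD2r.
  by have := rad_ge0 (x n); rewrite sS -natr1; lra.
(* For distinct indices, the image of the later point is farther from [y] than that of the earlier
   one, by more than the later index. For equal indices the last clause of [not_close_far]
   applies. *)
have far i j : j%:R < mdist (f (x i)) (g (x j)).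
  have [fi _ di] := cP (s i); have [_ gj _] := cP (s j).
  rewrite -/(x i) -/(x j) in fi di gj.
  have [ij|ji|eij] := ltngtP i j.
  - have := s_gt _ _ ij; have := radf (x i).
    by have := metric_triangle y (f (x i)) (g (x j)); lra.
  - have := s_gt _ _ ji; have := radg (x j).
    have := metric_triangle y (g (x j)) (f (x i)).
    have : j%:R <= i%:R :> R by rewrite ler_nat ltnW.
    by rewrite (metric_sym (g _)); lra.
  - by have := s_ge i; rewrite -eij; lra.
(* On a bounded set [f] and [g] differ by at most some [C], which [far] refutes at any index above
   [C]. *)
exists (range x).
  move=> /(coarse_map_dist_bounded f g)[C xC].
  have := far (Num.truncn C).+1 (Num.truncn C).+1.
  have := xC (x (Num.truncn C).+1) (imageT _ _).
  by have := truncnS_gt C; lra.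
(* If [z] is [r]-near both [f (x i)] and [g (x j)], then [far] forces [j < r + r]. Bounding [j]
   alone suffices: [g (x j)] then stays within [s N] of [y]. *)
move=> /coarsely_nearP[r]; apply; set N := (Num.truncn (r + r)).+1.
apply: (@bounded_ball _ _ y (s N + r)) => z.
case=> -[_ [_ [i _ <-] <-] zi] [_ [_ [j _ <-] <-] zj].
have jN : (j < N)%N.
  rewrite -(ltr_nat R); apply: lt_trans (truncnS_gt (r + r)).
  apply: lt_le_trans (far i j) _.
  by apply: le_trans (metric_triangle _ z _) _; rewrite metric_sym lerD.
have := s_gt _ _ jN; have := radg (x j); have := ler0n R N.
by have := metric_triangle y (g (x j)) z; rewrite (metric_sym (g _)); lra.
Qed.

Lemma corona_map_inj f g : corona_map f = corona_map g -> close_maps f g.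
Proof.
move=> fgE; apply: contrapT => /not_close_separated[A Aub]; apply.
have [F FA] := exists_coarse_ultrafilter Aub.
have /coronaP : \pi_(corona Y)%qT (cuf_push f F) =
                \pi_(corona Y)%qT (cuf_push g F).
  by rewrite -!corona_mapE fgE.
(* The preimages of [f @] A[and]g @[A] both contain [A], so these images belong to the two
   pushforwards. *)
by apply; apply: FA; exact: preimage_image.
Qed.

End separation.

Theorem theoremA (R : realType) : faithful (corona_functor R).
Proof.
move=> X Y; elim/quotW => f; elim/quotW => g fgE.
apply/coarse_classP/corona_map_inj.
rewrite -(corona_homE f) -(corona_homE g).
exact: (congr1 (fun h : continuousType (corona X) (corona Y) =>
  h : corona X -> corona Y) fgE).
Qed.
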